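(* Let $D$ be a finitely generated skew-field over $\mathbb{R}$ and let a finite solvable group $G$ act on $D$ via a homomorphism $G\to\mathrm{Aut}_{\mathbb{R}}(D)$. Then $D^G$ is a finitely generated skew-field over $\mathbb{R}$. In particular, this holds for $D=\mathbb{R}(\!\langle x_1,\dots,x_n\rangle\!)$.
   Context: A skew-field over $\mathbb{R}$ is a skew-field (division ring) that is an $\mathbb{R}$-algebra; it is finitely generated over $\mathbb{R}$ if it is generated as a skew-field (i.e. using ring operations and inverses) over $\mathbb{R}$ by finitely many elements. $\mathrm{Aut}_{\mathbb{R}}(D)$ is the group of $\mathbb{R}$-algebra automorphisms of $D$, and $D^G$ is the sub-skew-field of elements fixed by $G$. The free skew-field $\mathbb{R}(\!\langle x_1,\dots,x_n\rangle\!)$ is the universal skew-field of fractions of the free associative algebra $\mathbb{R}\langle x_1,\dots,x_n\rangle$. *)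

(* Defs.v *)
From HB Require Import structures.
From mathcomp Require Import all_boot all_order all_algebra all_fingroup.
From mathcomp Require Import all_solvable.
From mathcomp Require Import boolp classical_sets reals.
From mathcomp Require Import multinomials.monalg.

Set Implicit Arguments.
Unset Strict Implicit.
Unset Printing Implicit Defensive.

Local Open Scope classical_set_scope.
Local Open Scope ring_scope.

(* MathComp has no structure of (noncommutative) division rings. The ring
   structure [unitRingType] already entails [1 != 0], and [x^-1] is the
   two-sided inverse of every unit [x]. *)
Definition is_skew_field (K : unitRingType) : Prop :=
  forall x : K, x != 0 -> x \is a GRing.unit.

Section AlgebraOverR.
Variables (R : realType) (D : unitAlgType R).
Implicit Types S X E : set D.

(* [divalg_closed]: contains [1], stable under [a *: x + y] and [x / y].
   Since [0^-1 = 0], stability under [x / 0] is no extra condition. *)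
Definition sub_skew_field S : Prop := GRing.divalg_closed [in S].

Definition skew_field_gen X : set D := smallest sub_skew_field X.

Definition finitely_generated E : Prop :=
  sub_skew_field E /\ exists s : seq D, skew_field_gen [set` s] = E.

Record alg_automorphism := AlgAutomorphism {
  alg_aut_val :> {lrmorphism D -> D};
  alg_aut_bij : bijective alg_aut_val
}.

Definition acts_by (gT : finGroupType) (G : {group gT})
    (rho : gT -> alg_automorphism) : Prop :=
  {in G &, forall g h, rho (g * h)%g =1 rho g \o rho h}.

Definition fixed_points (gT : finGroupType) (G : {group gT})
    (rho : gT -> alg_automorphism) : set D :=
  [set x | forall g, g \in G -> rho g x = x].

End AlgebraOverR.

(* The universal skew-field of fractions, after P. M. Cohn: an initial object
   in the category of epic [A]-fields and specializations which moreover
   contains [A]. *)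
Section UniversalFieldOfFractions.
Variable A : nzRingType.

Definition epic (K : unitRingType) (f : {rmorphism A -> K}) : Prop :=
  smallest (fun S : set K => GRing.divring_closed [in S]) (range f) = setT.

(* A specialization is a ring homomorphism [phi], over [A], from a subring [S]
   of [K] containing the image of [A], such that every element of [S] outside
   the kernel of [phi] has its inverse in [S]. Here [phi] is total, and its
   values outside [S] are irrelevant. *)
Definition specialization (K L : unitRingType)
    (f : {rmorphism A -> K}) (g : {rmorphism A -> L}) : Prop :=
  exists (S : set K) (phi : K -> L),
    [/\ GRing.subring_closed [in S] /\ range f `<=` S,
        phi 1 = 1 /\ {in S &, {morph phi : x y / x - y}},
        {in S &, {morph phi : x y / x * y}},
        forall a : A, phi (f a) = g a &
        {in S, forall x, phi x != 0 -> x^-1 \in S}].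

(* There is at most one specialization between two epic [A]-fields, up to
   restriction of its domain, so that initiality amounts to existence. *)
Definition universal_field_of_fractions (K : unitRingType)
    (f : {rmorphism A -> K}) : Prop :=
  [/\ is_skew_field K, epic f, injective f &
      forall (L : unitRingType) (g : {rmorphism A -> L}),
        is_skew_field L -> epic g -> specialization f g].

End UniversalFieldOfFractions.

(* The algebra of the free monoid on [n] letters. *)
Notation free_algebra R n := {malg R[{fmonom 'I_n}]}.

(* [D] with [iota] is a model of [R(<x_1, ..., x_n>)], [x_i] being the image of
   the [i]-th letter. *)
Definition is_free_skew_field (R : realType) (n : nat) (D : unitAlgType R)
    (iota : {lrmorphism free_algebra R n -> D}) : Prop :=
  universal_field_of_fractions iota.

(* Main.v *)
(* Let E = D^G. By Artin's argument D has right dimension at most |G| over E;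
   let e be a finite right basis. Let F be the sub-skew-field of E generated by
   the coordinates on e of 1 and of the products x e_j, x running through the
   generators of D, and let V be the right F-span of e. The x in D with x V
   contained in V form a sub-skew-field, closed under inverses because V is
   finite-dimensional over F, and it contains the generators; hence it is D,
   and D = D 1 is contained in V. Comparing the coordinates of 1 and of c = c 1
   for c in E then gives E = F. *)
Require Import Defs.
From mathcomp Require Import all_boot all_order all_algebra all_fingroup.
From mathcomp Require Import all_solvable.
From mathcomp Require Import boolp classical_sets reals.
From mathcomp Require Import multinomials.monalg.

Set Implicit Arguments.
Unset Strict Implicit.
Unset Printing Implicit Defensive.

Import GRing.Theory.

Local Open Scope classical_set_scope.
Local Open Scope ring_scope.

(** * Closure properties of sub-skew-fields *)

Section SubSkewField.
Context {R : realType} {D : unitAlgType R} {S : set D}.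
Hypothesis subS : sub_skew_field S.

Lemma sub_skew_field1 : S 1.
Proof. by case: subS => + _ _; rewrite inE. Qed.

Lemma sub_skew_field_linear a x y : S x -> S y -> S (a *: x + y).
Proof.
case: subS => _ lin _ Sx Sy.
by have := lin a x y; rewrite !inE; apply.
Qed.

Lemma sub_skew_field_div x y : S x -> S y -> S (x / y).
Proof.
case: subS => _ _ div Sx Sy.
by have := div x y; rewrite !inE; apply.
Qed.

Lemma sub_skew_field0 : S 0.
Proof.
have := sub_skew_field_linear (- 1) sub_skew_field1 sub_skew_field1.
by rewrite scaleN1r addNr.
Qed.

Lemma sub_skew_field_scale a x : S x -> S (a *: x).
Proof. by move=> /(sub_skew_field_linear a)/(_ sub_skew_field0); rewrite addr0. Qed.

Lemma sub_skew_fieldD x y : S x -> S y -> S (x + y).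
Proof. by move=> Sx /(sub_skew_field_linear 1 Sx); rewrite scale1r. Qed.

Lemma sub_skew_fieldN x : S x -> S (- x).
Proof. by rewrite -scaleN1r; apply: sub_skew_field_scale. Qed.

Lemma sub_skew_fieldV x : S x -> S x^-1.
Proof. by move=> Sx; rewrite -div1r; apply: sub_skew_field_div => //; apply: sub_skew_field1. Qed.

Lemma sub_skew_fieldM x y : S x -> S y -> S (x * y).
Proof. by move=> Sx /sub_skew_fieldV; rewrite -{2}[y]invrK; apply: sub_skew_field_div. Qed.

Lemma sub_skew_field_sum (I : finType) (F : I -> D) :
  (forall i, S (F i)) -> S (\sum_i F i).
Proof.
move=> SF; apply: (big_ind S) => //; first exact: sub_skew_field0.
exact: sub_skew_fieldD.
Qed.

End SubSkewField.

Lemma sub_skew_fieldP {R : realType} {D : unitAlgType R} (S : set D) :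
  S 1 -> (forall a x y, S x -> S y -> S (a *: x + y)) ->
  (forall x y, S x -> S y -> S (x * y)) -> (forall x, S x -> S x^-1) ->
  sub_skew_field S.
Proof.
move=> S1 SL SM SV; split; first by rewrite inE.
- by move=> a x y; rewrite !inE; apply: SL.
- by move=> x y; rewrite !inE => Sx Sy; apply/SM/SV.
Qed.

Lemma sub_skew_field_setT {R : realType} (D : unitAlgType R) :
  sub_skew_field [set: D].
Proof. exact: sub_skew_fieldP. Qed.

Lemma skew_field_gen_sub {R : realType} {D : unitAlgType R} (X : set D) :
  sub_skew_field (skew_field_gen X).
Proof.
apply: sub_skew_fieldP.
- by move=> A [subA _]; apply: sub_skew_field1.
- by move=> a x y gx gy A XA; apply: sub_skew_field_linear (gx _ XA) (gy _ XA); case: XA.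
- by move=> x y gx gy A XA; apply: sub_skew_fieldM (gx _ XA) (gy _ XA); case: XA.
- by move=> x gx A XA; apply: sub_skew_fieldV (gx _ XA); case: XA.
Qed.

(** * Right linear algebra over a sub-skew-field of [D] *)

Section RightLinearAlgebra.
Context {R : realType} {D : unitAlgType R}.
Hypothesis skewD : is_skew_field D.

(** As [S] is a set and not a type, matrices keep their entries in [D] and carry this side
    condition. *)
Definition mx_in (S : set D) m n (A : 'M[D]_(m, n)) := forall i j, S (A i j).

Definition right_free (S : set D) n (e : 'rV[D]_n) :=
  forall c : 'cV_n, mx_in S c -> e *m c = 0 -> c = 0.

Definition right_span (S : set D) n (e : 'rV[D]_n) : set D :=
  [set v | exists2 c : 'cV_n, mx_in S c & v%:M = e *m c].

Section Over.
Context {S : set D}.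
Hypothesis subS : sub_skew_field S.

Lemma mx_inM m n p (A : 'M[D]_(m, n)) (B : 'M_(n, p)) :
  mx_in S A -> mx_in S B -> mx_in S (A *m B).
Proof.
move=> SA SB i j; rewrite mxE; apply: (sub_skew_field_sum subS) => k.
exact: (sub_skew_fieldM subS).
Qed.

Lemma mx_in_scalar (a : D) : S a -> mx_in S (a%:M : 'M_1).
Proof. by move=> Sa i j; rewrite !ord1 mxE eqxx. Qed.

(** Elimination by induction on the number of rows: a zero first row is dropped; otherwise the other
    rows are restricted to its kernel, which costs one row and one column. *)
Lemma wide_kernel m n (A : 'M[D]_(m, n)) : (m < n)%N -> mx_in S A ->
  exists c : 'cV_n, [/\ c != 0, mx_in S c & A *m c = 0].
Proof.
elim: m n A => [|m IHm] [//|n] A ltmn SA.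
  exists (const_mx 1); split; last by apply/matrixP => -[].
    by apply/eqP => /matrixP/(_ 0 0)/eqP; rewrite !mxE oner_eq0.
  by move=> i j; rewrite mxE; apply: (sub_skew_field1 subS).
pose u : 'rV_n.+1 := usubmx (A : 'M_(1 + m, _)).
pose d : 'M_(m, n.+1) := dsubmx (A : 'M_(1 + m, _)).
have SAu : mx_in S u by move=> i j; rewrite mxE.
have SAd : mx_in S d by move=> i j; rewrite mxE.
have A0 (c : 'cV_n.+1) : u *m c = 0 -> d *m c = 0 -> A *m c = 0.
  move=> uc dc; rewrite -[A](@vsubmxK _ 1).
  by rewrite [LHS](@mul_col_mx _ 1) -/u -/d uc dc col_mx0.
clearbody u d.
have [u0|[j uj_neq0]] : u = 0 \/ exists j, u 0 j != 0.
  have [[j uj]|u0] := pselect (exists j, u 0 j != 0); first by right; exists j.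
  left; apply/rowP => j; rewrite mxE; apply/eqP/negPn/negP => uj.
  by apply: u0; exists j.
  have [c [c_neq0 Sc dc0]] := IHm _ d (ltnW ltmn) SAd.
  by exists c; split=> //; apply: A0; rewrite // u0 mul0mx.
(* The columns of T form a basis of the right kernel of the row u. *)
pose T : 'M[D]_(n.+1, n) := \matrix_(i, k)
  if unlift j i is Some i' then (i' == k)%:R
  else - ((u 0 j)^-1 * u 0 (lift j k)).
have ST : mx_in S T.
  move=> i k; rewrite mxE; case: unlift => [i'|].
    by case: eqP => _; [apply: (sub_skew_field1 subS)|apply: (sub_skew_field0 subS)].
  apply/(sub_skew_fieldN subS)/(sub_skew_fieldM subS) => //.
  exact: (sub_skew_fieldV subS).
have uT0 : u *m T = 0.
  apply/rowP => k; rewrite !mxE (bigD1_ord j)//= mxE unlift_none.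
  rewrite mulrN mulrA divrr ?mul1r; last exact: skewD.
  rewrite (bigD1 k)//= mxE liftK eqxx mulr1 big1 ?addr0 ?addNr// => i /negbTE neq_ik.
  by rewrite mxE liftK neq_ik mulr0.
have [c [c_neq0 Sc dTc0]] := IHm _ (d *m T) ltmn (mx_inM SAd ST).
exists (T *m c); split; last 1 first.
- by apply: A0; rewrite mulmxA ?uT0 ?mul0mx.
(* Deleting row [j] of [T] leaves the identity, so [T *m c] repeats the entries of [c]. *)
- apply: contra_neq c_neq0 => Tc0; apply/colP => k.
  have /colP/(_ (lift j k)) := Tc0; rewrite !mxE => <-.
  rewrite (bigD1 k)//= mxE liftK eqxx mul1r big1 ?addr0// => i neq_ik.
  by rewrite mxE liftK eq_sym (negbTE neq_ik) mul0r.
- exact: mx_inM.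
Qed.

(** Scalars act on the right, so the dependence is solved for [v] by multiplying by [- t^-1] on that
    side. *)
Lemma right_span_col n (e : 'rV[D]_n) (c : 'cV_n) (t : D) :
  S t -> t != 0 -> mx_in S c -> forall v, e *m c + (v * t)%:M = 0 ->
  right_span S e v.
Proof.
move=> St t_neq0 Sc v /eqP; rewrite addr_eq0 => /eqP ec.
exists (c *m (- t^-1)%:M).
  apply: mx_inM => //; apply/mx_in_scalar/(sub_skew_fieldN subS).
  exact: (sub_skew_fieldV subS).
rewrite mulmxA ec -raddfN -scalar_mxM mulrNN -mulrA divrr ?mulr1//.
exact: skewD.
Qed.

Lemma right_spanM n (e : 'rV[D]_n) v t :
  right_span S e v -> S t -> right_span S e (v * t).
Proof.
move=> [c Sc ec] St; exists (c *m t%:M); last by rewrite scalar_mxM ec mulmxA.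
by apply: mx_inM => //; apply: mx_in_scalar.
Qed.

Lemma right_spanD n (e : 'rV[D]_n) v w :
  right_span S e v -> right_span S e w -> right_span S e (v + w).
Proof.
move=> [c Sc ec] [b Sb eb]; exists (c + b); last by rewrite raddfD /= ec eb mulmxDr.
by move=> i j; rewrite mxE; apply: (sub_skew_fieldD subS).
Qed.

Lemma right_span0 n (e : 'rV[D]_n) : right_span S e 0.
Proof.
exists 0; last by rewrite mulmx0 raddf0.
by move=> i j; rewrite mxE; apply: (sub_skew_field0 subS).
Qed.

(** Real scalars are central, so scaling by [a] is right multiplication by [a *: 1], an element of
    [S]. *)
Lemma right_spanZ n (e : 'rV[D]_n) (a : R) v :
  right_span S e v -> right_span S e (a *: v).
Proof.
rewrite -mulr_algr => Vv; apply: right_spanM => //.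
by apply/(sub_skew_field_scale subS)/(sub_skew_field1 subS).
Qed.

(** Left multiplication by [x] commutes with right scalars, so it need only be tested on the entries
    of [e]. *)
Lemma right_span_mull n (e : 'rV[D]_n) (x : D) :
  (forall j, right_span S e (x * e 0 j)) ->
  forall v, right_span S e v -> right_span S e (x * v).
Proof.
move=> Vxe v [c Sc /matrixP/(_ 0 0)]; rewrite !mxE eqxx mulr1n => ->.
rewrite mulr_sumr; apply: big_ind => [||j _].
- exact: right_span0.
- by move=> y z; apply: right_spanD.
- by rewrite mulrA; apply: right_spanM.
Qed.

Lemma right_span_mem n (e : 'rV[D]_n) j : right_span S e (e 0 j).
Proof.
exists (delta_mx j 0).
  move=> i k; rewrite mxE; case: (_ && _).
    exact: (sub_skew_field1 subS).
  exact: (sub_skew_field0 subS).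
by rewrite -colE; apply/matrixP => i k; rewrite !ord1 !mxE eqxx.
Qed.

(* Left multiplication by x is injective and right linear over S, so on a
   finite-dimensional right S-space it preserves it is also onto. *)
Lemma right_span_divl n (e : 'rV[D]_n) (x : D) : right_free S e -> x != 0 ->
  (forall v, right_span S e v -> right_span S e (x * v)) ->
  forall v, right_span S e v -> right_span S e (x^-1 * v).
Proof.
move=> free_e x_neq0 stable_x v [b Sb eb].
have xU : x \is a GRing.unit by apply: skewD.
have [M SM xe] : exists2 M : 'M_n, mx_in S M & x *: e = e *m M.
  have /choice[f fP] j : exists c : 'cV_n, mx_in S c /\ (x * e 0 j)%:M = e *m c.
    by have [c Sc ?] := stable_x _ (right_span_mem e j); exists c.
  exists (\matrix_(i, j) f j i 0).
    by move=> i j; rewrite mxE; case: (fP j).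
  apply/rowP => j; have [_ /matrixP/(_ 0 0)] := fP j; rewrite !mxE eqxx mulr1n => ->.
  by apply: eq_bigr => i _; rewrite mxE.
(* [M] is a matrix of left multiplication by [x]; appending the coordinates [b] of [v] gives more
   columns than rows, hence a relation [M c + b t = 0]. *)
have [||z [z_neq0 Sz Mz0]] := @wide_kernel n (n + 1) (row_mx M b).
- by rewrite addn1.
- by move=> i j; rewrite mxE; case: split => ?.
pose c := usubmx z; pose t := dsubmx z 0 0.
have Sc : mx_in S c by move=> i j; rewrite mxE.
have St : S t by rewrite /t mxE.
have Mcbt : M *m c + b *m t%:M = 0.
  rewrite -Mz0 -[z in RHS]vsubmxK mul_row_col -/c; congr (_ + _ *m _).
  by rewrite [RHS]mx11_scalar.
have xec : x *: (e *m c) + (v * t)%:M = 0.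
  by rewrite scalar_mxM eb -mulmxA scalemxAl xe -mulmxA -mulmxDr Mcbt mulmx0.
have ect : e *m c + (x^-1 * v * t)%:M = 0.
  rewrite -[e *m c]scale1r -(mulVr xU) -scalerA -mulrA.
  by rewrite -[X in _ + X]scale_scalar_mx -scalerDr xec scaler0.
(* If [t] vanished, freeness of [e] would give [c = 0], hence [z = 0]. *)
apply: (right_span_col St _ Sc ect); apply: contra_neq z_neq0 => t0.
have c0 : c = 0 by apply: free_e => //; move: ect; rewrite t0 mulr0 raddf0 addr0.
rewrite -[z]vsubmxK -/c c0 [dsubmx z]mx11_scalar -/t t0 raddf0.
exact: col_mx0.
Qed.

End Over.

Lemma finitely_generated_right_finite (E : set D) n (e : 'rV[D]_n) :
  sub_skew_field E -> right_free E e -> right_span E e = setT ->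
  finitely_generated [set: D] -> finitely_generated E.
Proof.
move=> subE free_e span_e [_ [s gen_s]]; split=> //.
have /choice[f fP] v : exists c : 'cV_n, mx_in E c /\ v%:M = e *m c.
  have [c Ec ec] : right_span E e v by rewrite span_e.
  by exists c.
pose t := [seq f v i 0 | v <- 1 :: [seq x * e 0 j | x <- s, j <- enum 'I_n],
                         i <- enum 'I_n].
exists t; apply/seteqP; split.
  apply: smallest_sub => // y /allpairsP[[v i] [_ _ ->]].
  by case: (fP v) => + _; apply.
pose F := skew_field_gen [set` t]; rewrite -/(skew_field_gen _) -/F.
have subF : sub_skew_field F by apply: skew_field_gen_sub.
have FE : F `<=` E.
  apply: smallest_sub => // y /allpairsP[[v i] [_ _ ->]].
  by case: (fP v) => + _; apply.
have spanF v : v \in 1 :: [seq x * e 0 j | x <- s, j <- enum 'I_n] ->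
    right_span F e v.
  move=> vs; exists (f v); last by case: (fP v).
  move=> i j; rewrite ord1; apply: sub_gen_smallest => /=.
  by apply/allpairsP; exists (v, i); rewrite mem_enum.
have free_eF : right_free F e.
  by move=> c Fc; apply: free_e => i j; apply: FE.
pose stab : set D := [set x | forall v, right_span F e v -> right_span F e (x * v)].
have stabT : stab = setT.
  apply/seteqP; split=> //; rewrite -gen_s; apply: smallest_sub.
    apply: sub_skew_fieldP => /=.
    - by move=> v; rewrite mul1r.
    - move=> a x y sx sy v Vv; rewrite mulrDl -scalerAl.
      by apply: (right_spanD subF); [apply/(right_spanZ subF)/sx|apply: sy].
    - by move=> x y sx sy v Vv; rewrite -mulrA; apply/sx/sy.
    (* The default [0^-1 = 0] makes [0] a separate case; for [x != 0] the finite dimension of the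
       span is used. *)
    - move=> x sx; have [->|x_neq0] := eqVneq x 0.
        by move=> v _; rewrite invr0 mul0r; apply: right_span0.
      exact: (right_span_divl subF).
  move=> x /= xs; apply: (right_span_mull subF) => j.
  apply: spanF; rewrite inE; apply/orP; right.
  by apply/allpairsP; exists (x, j); rewrite mem_enum.
have span1 : right_span F e 1 by apply: spanF; rewrite inE eqxx.
move=> c Ec; have [b Fb eb] : right_span F e c.
  have : stab c by rewrite stabT.
  by move=> /(_ _ span1); rewrite mulr1.
have [a Fa ea] := span1.
(* From [1 = e a] follows [c = e (a c)]; as [c] lies in [E], freeness of [e] over [E] identifies
   [a c] with [b], whose entries lie in [F]. *)
have ac : a *m c%:M = b.
  apply/eqP; rewrite -subr_eq0; apply/eqP/free_e.
    move=> i j; rewrite !mxE; apply: (sub_skew_fieldD subE).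
      rewrite big_ord1 ord1 !mxE; apply: (sub_skew_fieldM subE); first exact: FE.
      by rewrite [j]ord1.
    exact/(sub_skew_fieldN subE)/FE.
  by rewrite mulmxBr mulmxA -ea -eb -scalar_mxM mul1r subrr.
(* Since [1 != 0], some coordinate of [1] is nonzero, and dividing by it recovers [c] inside [F]. *)
have [i ai_neq0] : exists i, a i 0 != 0.
  apply: contrapT => a0; have : e *m a != 0.
    by rewrite -ea; apply/eqP => /matrixP/(_ 0 0)/eqP; rewrite !mxE oner_eq0.
  move=> /eqP; apply; suff -> : a = 0 by rewrite mulmx0.
  apply/colP => i; rewrite mxE; apply/eqP/negPn/negP => ai.
  by apply: a0; exists i.
have -> : c = (a i 0)^-1 * b i 0.
  by rewrite -ac mxE big_ord1 mxE eqxx mulr1n mulKr//; apply: skewD.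
by apply: (sub_skew_fieldM subF) => //; apply: (sub_skew_fieldV subF).
Qed.

(** A free family of maximal length spans, since a vector outside its span could be appended. *)
Lemma right_basis_of_bound (E : set D) N : sub_skew_field E ->
  (forall n (e : 'rV[D]_n), right_free E e -> (n <= N)%N) ->
  exists n (e : 'rV[D]_n), right_free E e /\ right_span E e = setT.
Proof.
move=> subE bound.
pose P n := `[< exists e : 'rV[D]_n, right_free E e >].
have exP : exists n, P n.
  (* The empty family is free, so a maximal length exists. *)
  by exists 0%N; apply/asboolP; exists 0 => c _ _; apply/colP => -[].
have leN n : P n -> (n <= N)%N by move=> /asboolP[e] /bound.
case: (ex_maxnP exP leN) => n /asboolP[e free_e] max_n.
exists n, e; split=> //; apply/seteqP; split=> // v _.
apply: contrapT => nVv.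
suff /asboolP/max_n : exists e : 'rV[D]_(n + 1), right_free E e.
  by rewrite addn1 ltnn.
exists (row_mx e v%:M) => z Ez.
pose c := usubmx z; pose t := dsubmx z 0 0.
have Ec : mx_in E c by move=> i j; rewrite mxE.
have Et : E t by rewrite /t mxE.
rewrite -[z]vsubmxK mul_row_col -/c [dsubmx z]mx11_scalar -/t -scalar_mxM => ect.
have t0 : t = 0.
  by apply/eqP/negPn/negP => t_neq0; apply: nVv; apply: (right_span_col subE Et _ Ec ect).
have c0 : c = 0 by apply: free_e => //; move: ect; rewrite t0 mulr0 raddf0 addr0.
by rewrite c0 t0 raddf0 col_mx0.
Qed.

(** * Artin's dimension bound over the fixed points of a finite group *)

Section Artin.
Context {gT : finGroupType} {G : {group gT}} {rho : gT -> alg_automorphism D}.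
Hypothesis act_rho : acts_by G rho.
Let E := fixed_points G rho.

Lemma fixed_points_sub_skew_field : sub_skew_field E.
Proof.
apply: sub_skew_fieldP => /=.
- by move=> g _; rewrite rmorph1.
- by move=> a x y Ex Ey g Gg; rewrite linearP /= Ex ?Ey.
- by move=> x y Ex Ey g Gg; rewrite rmorphM /= Ex ?Ey.
- move=> x Ex g Gg; have [->|x_neq0] := eqVneq x 0; first by rewrite invr0 rmorph0.
  by rewrite rmorphV /= ?Ex//; apply: skewD.
Qed.

(** [acts_by] states multiplicativity only; [rho 1] is then idempotent, and an injective idempotent
    map is the identity. *)
Lemma acts_by1 x : rho 1%g x = x.
Proof.
have [r rK _] := alg_aut_bij (rho 1%g); apply: (can_inj rK).
by rewrite -[in RHS](mulg1 1%g) act_rho.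
Qed.

(* Artin's argument: normalise one entry of a kernel vector c to 1. If c is not
   fixed by some h, then h c - c is a kernel vector of smaller support. *)
Lemma fixed_kernel n (u : 'rV[D]_n) (c : 'cV_n) : c != 0 ->
  (forall g, g \in G -> map_mx (rho g) u *m c = 0) ->
  exists b : 'cV_n, [/\ b != 0, mx_in E b & u *m b = 0].
Proof.
have [k] := ubnP #|[pred i | c i 0 != 0]|; elim: k c => // k IHk c ltck c_neq0 uc0.
have [i ci_neq0] : exists i, c i 0 != 0.
  apply: contrapT => nc; case/eqP: c_neq0; apply/colP => i; rewrite mxE.
  by apply/eqP/negPn/negP => ci; apply: nc; exists i.
pose b := c *m ((c i 0)^-1)%:M.
have bE l : b l 0 = c l 0 / c i 0 by rewrite mxE big_ord1 mxE eqxx.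
have bi1 : b i 0 = 1 by rewrite bE divrr//; apply: skewD.
have ub0 g : g \in G -> map_mx (rho g) u *m b = 0.
  by move=> Gg; rewrite mulmxA uc0// mul0mx.
clearbody b.
have [fix_b|] := pselect (forall h, h \in G -> map_mx (rho h) b = b).
  exists b; split.
  - by apply/eqP => /colP/(_ i)/eqP; rewrite bi1 mxE oner_eq0.
  - by move=> l j h Gh; have /matrixP/(_ l j) := fix_b h Gh; rewrite mxE.
  - rewrite -[RHS](ub0 1%g)//; congr (_ *m _).
    by apply/matrixP => l j; rewrite mxE acts_by1.
move=> /existsNP[h /not_implyP[Gh hb]].
apply: (IHk (map_mx (rho h) b - b)).
(* Zeros of [c] stay zeros, while entry [i] now vanishes because [rho h] fixes [b i 0 = 1]. *)
- rewrite -ltnS; apply: leq_trans ltck; rewrite ltnS; apply: proper_card.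
  apply/properP; split.
    apply/fintype.subsetP => l; rewrite !inE; apply: contra_neq => cl0.
    by rewrite !mxE !bE cl0 mul0r rmorph0 subrr.
  by exists i; rewrite !inE// negbK !mxE bi1 rmorph1 subrr.
- by rewrite subr_eq0; apply/eqP.
- move=> g Gg; rewrite mulmxBr ub0// subr0.
  (* Applying [rho h] to the equation for [h^-1 * g] gives the equation for [g] on
     [map_mx (rho h) b]. *)
  have := ub0 (h^-1 * g)%g; rewrite groupM ?groupV// => /(_ isT).
  move=> /(congr1 (map_mx (rho h))); rewrite map_mxM map_mx0 => <-; congr (_ *m _).
  apply/matrixP => l j; rewrite !mxE -[RHS]/((rho h \o rho (h^-1 * g)%g) _).
  by rewrite -act_rho ?groupM ?groupV// mulKVg.
Qed.

(** Stack the conjugates of [u], one row per element of [G]. With more than [#|G|] columns this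
    matrix has a kernel vector over [D], which [fixed_kernel] turns into a dependence over [E]. *)
Lemma right_free_fixed_points n (u : 'rV[D]_n) :
  right_free E u -> (n <= #|G|)%N.
Proof.
move=> free_u; rewrite leqNgt; apply/negP => ltGn.
pose A : 'M[D]_(#|G|, n) := \matrix_(i, j) rho (enum_val i) (u 0 j).
have [//|c [c_neq0 _ Ac0]] := wide_kernel (sub_skew_field_setT D) (A := A) ltGn.
have [//||b [/eqP b_neq0 Eb ub0]] := @fixed_kernel _ u c.
  move=> g Gg; apply/rowP => j.
  have /matrixP/(_ (enum_rank_in Gg g) j) := Ac0; rewrite !mxE => row0; rewrite -[RHS]row0.
  by apply: eq_bigr => l _; rewrite !mxE enum_rankK_in.
by apply: b_neq0; apply: free_u.
Qed.

Lemma finitely_generated_fixed_points :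
  finitely_generated [set: D] -> finitely_generated E.
Proof.
have subE := fixed_points_sub_skew_field.
have [n [e [free_e span_e]]] := right_basis_of_bound subE right_free_fixed_points.
exact: (finitely_generated_right_finite subE free_e span_e).
Qed.

End Artin.
End RightLinearAlgebra.

(** * Finite generation of the free skew-field *)

Lemma finitely_generated_free_skew_field (R : realType) (n : nat) (D : unitAlgType R)
    (iota : {lrmorphism free_algebra R n -> D}) :
  is_free_skew_field iota -> finitely_generated [set: D].
Proof.
case=> skewD epi_iota _ _; split; first exact: sub_skew_field_setT.
exists [seq iota << fmu i >> | i <- enum 'I_n].
set X := [set` _]; have subX := skew_field_gen_sub X.
(* As [iota] is epic, it suffices that the skew-field generated by the letters contains the image of
   [iota]; by linearity this reduces to monomials. *)
apply/seteqP; split=> //; rewrite -epi_iota; apply: smallest_sub.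
  exact: GRing.divalg_closedBdiv.
move=> _ [p _ <-]; rewrite [p]monalgE raddf_sum /=.
apply: big_ind => [||m _]; first exact: (sub_skew_field0 subX).
  exact: (sub_skew_fieldD subX).
have -> : << p@_m *g m >> = p@_m *: << m >> :> {malg R[{fmonom 'I_n}]}.
  by rewrite -mul_malgC [RHS]fgmulUU mulr1 mul1m.
rewrite linearZ; apply: (sub_skew_field_scale subX).
(* A monomial is the product of the letters of its word [w]. *)
case: m => w; elim: w => [|i w IHw].
  have -> : << FMonom [::] >> = 1 :> {malg R[{fmonom 'I_n}]}.
    by rewrite -mpolyC1E; congr mkmalgU; apply: val_inj; rewrite /= fm1.
  by rewrite rmorph1; apply: (sub_skew_field1 subX).
have -> : << FMonom (i :: w) >> = << fmu i >> * << FMonom w >> :> {malg R[{fmonom 'I_n}]}.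
  rewrite [RHS]fgmulUU mulr1; congr mkmalgU; apply: val_inj.
  by rewrite /= fmM fmuE.
rewrite rmorphM; apply: (sub_skew_fieldM subX) => //.
apply: sub_gen_smallest => /=; apply/mapP; by exists i; rewrite ?mem_enum.
Qed.

Theorem theorem3p10 (R : realType) :
  (forall D : unitAlgType R,
     is_skew_field D -> finitely_generated [set: D] ->
     forall (gT : finGroupType) (G : {group gT})
            (rho : gT -> alg_automorphism D),
       solvable G -> acts_by G rho ->
       finitely_generated (fixed_points G rho)) /\
  (forall (n : nat) (D : unitAlgType R)
          (iota : {lrmorphism free_algebra R n -> D}),
     is_free_skew_field iota ->
     forall (gT : finGroupType) (G : {group gT})
            (rho : gT -> alg_automorphism D),
       solvable G -> acts_by G rho ->
       finitely_generated (fixed_points G rho)).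
Proof.
split=> [D skewD fgD gT G rho _ act_rho|n D iota freeD gT G rho _ act_rho].
  exact: finitely_generated_fixed_points.
apply: finitely_generated_fixed_points => //; first by case: freeD.
exact: finitely_generated_free_skew_field freeD.
Qed.
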